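(* Let $n\ge 3$ and let $A$ and $B$ be $n$-by-$n$ weighted shift matrices with (complex) weights $a_1,\ldots,a_n$ and $b_1,\ldots,b_n$, respectively. Suppose that $A$ has at most two zero weights (i.e. at most two indices $j\in\{1,\dots,n\}$ satisfy $a_j=0$). Then $A$ is unitarily equivalent to $B$ if and only if $a_1\cdots a_n=b_1\cdots b_n$ and, for some fixed $k$, $1\le k\le n$, $|a_j|=|b_{k+j}|$ for all $j$, $1\le j\le n$ (where $b_{n+j}\equiv b_j$).
   Context: An $n$-by-$n$ ($n\ge 3$) weighted shift matrix with weights $a_1,\ldots,a_n\in\mathbb{C}$ is the complex matrix whose $(j,j+1)$-entry is $a_j$ for $1\le j\le n-1$, whose $(n,1)$-entry is $a_n$, and whose other entries are all $0$. Indices of weights are read modulo $n$: $b_{n+j}=b_j$. Two $n$-by-$n$ complex matrices $A,B$ are unitarily equivalent if $B=U^*AU$ for some unitary $U$. *)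

(* Defs.v *)
From HB Require Import structures.
From mathcomp Require Import all_boot all_order all_algebra.
From mathcomp Require Import sesquilinear spectral.
From mathcomp Require Import reals.
From mathcomp Require Import complex.

Set Implicit Arguments.
Unset Strict Implicit.
Unset Printing Implicit Defensive.

Import Order.TTheory GRing.Theory Num.Theory.

Local Open Scope ring_scope.
Local Open Scope sesquilinear_scope.

(* Rows, columns and weights are numbered from 0, so [a i] is the weight a_{i+1}.
   As [ordS i] is i.+1 modulo n, the weights a_1, ..., a_{n-1} lie on the
   superdiagonal and the last weight a_n in the lower left corner. *)
Definition weighted_shift (C : nzRingType) (n : nat) (a : 'I_n -> C) : 'M[C]_n :=
  \matrix_(i, j) (if j == ordS i then a i else 0).

Definition unitarily_equivalent (C : numClosedFieldType) (n : nat)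
    (A B : 'M[C]_n) : Prop :=
  exists2 U : 'M[C]_n, U \is unitarymx & B = U^t* *m A *m U.

(* Main.v *)
Require Import Defs.
From mathcomp Require Import all_boot all_order all_algebra all_fingroup.
From mathcomp Require Import sesquilinear spectral.
From mathcomp Require Import reals.
From mathcomp Require Import complex.
From mathcomp Require Import zify.

Set Implicit Arguments.
Unset Strict Implicit.
Unset Printing Implicit Defensive.

Import Order.TTheory GRing.Theory Num.Theory.

Local Open Scope ring_scope.
Local Open Scope sesquilinear_scope.

(** Write [A] and [B] for the two weighted shifts, [^H] for the adjoint, and read
indices cyclically.

Suppose that [A U = U B] with [U] unitary; then also [A^H U = U B^H].
Determinants give the equality of the products, since the determinant of a
weighted shift is the product of its weights up to a sign that depends on [n]
only. For the moduli, [A^k (A^H)^k] and [A^H A] are diagonal: their [i]-th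
entries are [|a_i ... a_(i+k-1)|^2] and [|a_(i-1)|^2]. [U] intertwines these
diagonal matrices with those of [B], and this means that whenever the entry
[U i j] is nonzero, index [i] for [a] and index [j] for [b] give the same
values. As [det U] is nonzero, some term of its Leibniz expansion is nonzero,
so that one permutation [s] achieves [U i (s i) <> 0] for all [i] at once: it
accounts for the multiplicities of the joint eigenvalues without any discussion
of eigenspaces ([det_neq0_transversal], [diag_intertwine]).

What remains is combinatorics of cyclic words ([rotated_of_prefix_products]).
Equal products of the prefixes that start at [i] and [s i] give equal letters
there, up to and including the first zero. If [a] has at most one zero, then
starting just after it recovers the whole word. If [a] has two zeros, they cut
the cycle into two blocks that occur in [b] at the starting points given by
[s]. These starting points are distinct by injectivity of [s], and each of them
follows a zero of [b]; so the two blocks cannot overlap in [b], they fill it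
up, and on a cycle two blocks can be arranged in only one way up to rotation.

Conversely, if [|a_j| = |b_(j+k)|] and the products agree, there are phases
[u_j] with [a_j u_j = b_(j+k)] and product [1]; if some [a_m] vanishes, the
freedom in choosing [u_m] secures the latter ([phases_exist]). Product [1] is
the condition for [u_j] to be of the form [d_(j+1) / d_j] on the cycle
([cyclic_primitive]), and the monomial matrix with entries [d_j] at
[(j, j + k)] is then a unitary equivalence. *)

(** * Monomial matrices *)

Section Monomial.

Variables (C : numClosedFieldType) (n : nat).
Implicit Types (d e : 'I_n -> C) (s t : 'S_n).

(** A permutation matrix with its rows scaled. Weighted shifts, diagonal matrices
and the unitary of the converse direction all have this form, which is closed
under product and adjoint. *)
Definition monomial_mx d s : 'M[C]_n := \matrix_(i, j) (d i *+ (s i == j)).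

Lemma mul_monomial_mx d e s t :
  monomial_mx d s *m monomial_mx e t = monomial_mx (fun i => d i * e (s i)) (s * t)%g.
Proof.
apply/matrixP => i j; rewrite !mxE (bigD1 (s i)) //= big1 ?addr0 => [|k sik].
  by rewrite !mxE eqxx permM mulrnAr mulr1n.
by rewrite !mxE eq_sym (negPf sik) mul0r.
Qed.

Lemma trmxC_monomial_mx d s :
  (monomial_mx d s)^t* = monomial_mx (fun i => (d (s^-1%g i))^*) s^-1%g.
Proof.
apply/matrixP => i j; rewrite !mxE rmorphMn /=.
case: (eqVneq (s j) i) => [<-|sji]; first by rewrite permK eqxx.
by rewrite -(inj_eq (@perm_inj _ s)) permKV eq_sym (negPf sji).
Qed.

Lemma eq_monomial_mx d e s : d =1 e -> monomial_mx d s = monomial_mx e s.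
Proof. by move=> de; apply/matrixP => i j; rewrite !mxE de. Qed.

Lemma monomial_mx1 : monomial_mx (fun=> 1) 1%g = 1%:M.
Proof. by apply/matrixP => i j; rewrite !mxE perm1. Qed.

Lemma det_monomial_mx d s : \det (monomial_mx d s) = \prod_i d i * (-1) ^+ s.
Proof.
have -> : monomial_mx d s = diag_mx (\row_i d i) *m perm_mx s.
  by apply/matrixP => i j; rewrite mul_diag_mx !mxE mulr_natr.
rewrite det_mulmx det_diag det_perm; congr (_ * _).
by apply: eq_bigr => i _; rewrite mxE.
Qed.

Lemma monomial_mx_unitary d s :
  (forall i, `|d i| = 1) -> monomial_mx d s \is unitarymx.
Proof.
move=> d1; apply/unitarymxP; rewrite trmxC_monomial_mx mul_monomial_mx mulgV.
rewrite -monomial_mx1; apply: eq_monomial_mx => i.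
by rewrite permK -normCK d1 expr1n.
Qed.

(** Compare the [(i, j)] entries [d i * U i j] and [U i j * e j]. *)
Lemma diag_intertwine d e (U : 'M[C]_n) i j :
    monomial_mx d 1%g *m U = U *m monomial_mx e 1%g ->
  U i j != 0 -> d i = e j.
Proof.
move=> /matrixP/(_ i j); rewrite !mxE (bigD1 i) //= [RHS](bigD1 j) //= !big1.
- rewrite !addr0 !mxE !perm1 !eqxx mulrC => dUe Uij.
  exact: (mulfI Uij).
- by move=> k kj; rewrite !mxE perm1 (negPf kj) mulr0.
- by move=> k ki; rewrite !mxE perm1 eq_sym (negPf ki) mul0r.
Qed.

(** Some term of the Leibniz expansion of the determinant is nonzero. *)
Lemma det_neq0_transversal (U : 'M[C]_n) :
  \det U != 0 -> exists s : 'S_n, forall i, U i (s i) != 0.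
Proof.
move=> dU0; suff /existsP[s /forallP sP] : [exists s : 'S_n, forall i, U i (s i) != 0].
  by exists s.
apply: contraNT dU0 => /existsPn noS; apply/eqP; apply: big1 => s _.
have /forallPn[i /negPn/eqP Ui0] := noS s.
by rewrite (bigD1 i) //= Ui0 mul0r mulr0.
Qed.

End Monomial.

(** * Cyclic words determined by their prefix products *)

Section CyclicIndices.

Variable n : nat.
Implicit Types (i j : 'I_n).

Local Notation step k := (iter k (@ordS n)).

Lemma val_step k i : step k i = ((i + k) %% n)%N :> nat.
Proof.
elim: k => [|k IHk]; first by rewrite addn0 modn_small.
by rewrite /= IHk -addn1 modnDml addn1 addnS.
Qed.

Lemma step_period i : step n i = i.
Proof. by apply: val_inj; rewrite /= val_step modnDr modn_small. Qed.

Lemma step_surj i j : exists2 r, (1 <= r <= n)%N & j = step r i.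
Proof.
have [ltin ltjn] := (ltn_ord i, ltn_ord j).
case: (ltnP i j) => ij.
  exists (j - i)%N; first by lia.
  by apply: val_inj; rewrite /= val_step subnKC 1?ltnW // modn_small.
exists (j + n - i)%N; first by lia.
apply: val_inj; rewrite /= val_step subnKC ?modnDr ?modn_small //.
by apply: leq_trans (ltnW ltin) _; rewrite leq_addl.
Qed.

Lemma step_neq k i : (0 < k < n)%N -> step k i != i.
Proof.
move=> kn; apply/eqP => /(congr1 val); rewrite /= val_step => eqi.
have ltin := ltn_ord i; case: (ltnP (i + k) n) => ik.
  by rewrite modn_small in eqi; lia.
move: eqi; rewrite -(subnK ik) modnDr modn_small; lia.
Qed.

Lemma step_ordS k i : step k (ordS i) = step k.+1 i.
Proof. by rewrite -iterSr. Qed.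

Definition rotation : 'S_n := perm (@ordS_inj n).

Lemma rotationX k i : (rotation ^+ k)%g i = step k i :> 'I_n.
Proof. by rewrite permX; apply: eq_iter => j; rewrite permE. Qed.

Variable F : idomainType.
Implicit Types (x y : 'I_n -> F).

(** Divide the product of length [k + 1] by the nonzero one of length [k]. The
letter at [k] itself may be zero, so the first zero of the word is seen too. *)
Lemma prefix_products_agree x y i j k :
    (forall m, \prod_(t < m) x (step t i) = \prod_(t < m) y (step t j)) ->
    (forall t, (t < k)%N -> x (step t i) != 0) ->
  x (step k i) = y (step k j).
Proof.
move=> pref x0.
have Pk0 : \prod_(t < k) x (step t i) != 0.
  by apply/prodf_neq0 => t _; apply: x0.
by have := pref k.+1; rewrite !big_ord_recr /= -pref => /(mulfI Pk0).
Qed.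

Lemma rotated_of_agree x y i j :
    (forall t, (t < n)%N -> x (step t i) = y (step t j)) ->
  exists k, (1 <= k <= n)%N /\ forall l, x l = y (step k l).
Proof.
have [r rn ->] := step_surj i j => xy.
exists r; split=> // l; have [t /andP[t0 tn] ->] := step_surj i l.
move: tn; rewrite leq_eqVlt => /orP[/eqP->|tn].
  by rewrite !step_period; apply: (xy 0%N); apply: leq_ltn_trans (ltn_ord i).
by rewrite xy // -!iterD addnC.
Qed.

(** Two is the largest number of zeros for which this holds for all [n]: three
blocks of different lengths, separated by three zeros, can be put together in
two cyclic orders that are not rotations of each other. The hypothesis about
[ord_pred] tells that a start of a block of [x] goes to a start of a block of
[y], and not to the middle of one. *)
Lemma rotated_of_prefix_products x y (s : 'I_n -> 'I_n) :
    injective s ->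
    (forall i k,
      \prod_(t < k) x (step t i) = \prod_(t < k) y (step t (s i))) ->
    (forall i, x (ord_pred i) = y (ord_pred (s i))) ->
    (0 < n)%N -> (#|[set j | x j == 0%R]| <= 2)%N ->
  exists k, (1 <= k <= n)%N /\ forall j, x j = y (step k j).
Proof.
move=> s_inj pref back n0 cardZ.
have agree i k := @prefix_products_agree x y i (s i) k (pref i).
(* No zero: any starting index will do. *)
have [/existsP[z1 /eqP xz1]|/existsPn nz] := boolP [exists z, x z == 0%R]; last first.
  apply: (@rotated_of_agree _ _ (Ordinal n0) (s (Ordinal n0))) => t _.
  by apply: agree => *; apply: nz.
(* A single zero [z1]: the word that starts just after it ends with it. *)
have [/existsP[z2 /andP[z21 /eqP xz2]]|/existsPn nz] :=
    boolP [exists z, (z != z1) && (x z == 0%R)]; last first.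
  apply: (@rotated_of_agree _ _ (ordS z1) (s (ordS z1))) => t tn.
  apply: agree => u ut; rewrite step_ordS; apply: contraTN isT => xu.
  by have := nz (step u.+1 z1); rewrite xu andbT step_neq //; lia.
(* Two zeros: one block of length [p] runs from after [z1] to [z2], the other
   one of length [n - p] from after [z2] to [z1]. *)
have zeros z : x z = 0 -> (z == z1) || (z == z2).
  move=> xz; have : [set z1; z2] == [set j | x j == 0%R].
    rewrite eqEcard cards2 eq_sym z21 cardZ andbT.
    by apply/subsetP => u; rewrite !inE => /orP[]/eqP->; apply/eqP.
  by move=> /eqP/setP/(_ z); rewrite !inE xz eqxx.
have [p /andP[p0 pn] z2E] := step_surj z1 z2.
have {}pn : (p < n)%N.
  rewrite ltn_neqAle pn andbT; apply: contraNneq z21 => pn'.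
  by rewrite z2E pn' step_period.
have z1E : z1 = step (n - p) z2 by rewrite z2E -iterD subnK ?step_period // ltnW.
have gap z z' u q : z' = step q z -> (0 < q < n)%N -> (0 < u < q)%N ->
    (step u z != z) && (step u z != z').
  move=> -> qn uq; rewrite step_neq /=; last by lia.
  rewrite -(subnK (_ : u <= q)%N) ?iterD 1?eq_sym ?step_neq //; lia.
have block1 t : (t < p)%N -> x (step t (ordS z1)) = y (step t (s (ordS z1))).
  move=> tp; apply: agree => u ut; rewrite step_ordS.
  apply/eqP => /zeros; apply/negP; rewrite negb_or.
  by apply: (gap _ _ _ _ z2E); lia.
have block2 t : (t < n - p)%N -> x (step t (ordS z2)) = y (step t (s (ordS z2))).
  move=> tp; apply: agree => u ut; rewrite step_ordS.
  apply/eqP => /zeros; apply/negP; rewrite orbC negb_or.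
  by apply: (gap _ _ _ _ z1E); lia.
have before z : x z = 0 -> y (ord_pred (s (ordS z))) = 0.
  by move=> <-; rewrite -back ordSK.
(* The images of the two starting points lie [r] places apart; as [y] vanishes
   just before each of them, neither falls inside the image of the other block,
   so that [p <= r] and [n - p <= n - r]. *)
have [r /andP[r0 rn] sE] := step_surj (s (ordS z1)) (s (ordS z2)).
have {}rn : (r < n)%N.
  rewrite ltn_neqAle rn andbT; apply: contraNneq z21 => rn'.
  by move: sE; rewrite rn' step_period => /s_inj/ordS_inj->.
have sE' : s (ordS z1) = step (n - r) (s (ordS z2)).
  by rewrite sE -iterD subnK ?step_period // ltnW.
have pr : (p <= r)%N.
  rewrite leqNgt; apply/negP => rp.
  have := before _ xz2; rewrite sE -(prednK r0) iterS ordSK -block1; last by lia.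
  rewrite step_ordS => /zeros; apply/negP; rewrite negb_or.
  by apply: (gap _ _ _ _ z2E); lia.
have rp : (r <= p)%N.
  rewrite leqNgt; apply/negP => rp.
  have nr : (0 < n - r)%N by lia.
  have := before _ xz1; rewrite sE' -(prednK nr) iterS ordSK -block2; last by lia.
  rewrite step_ordS => /zeros; apply/negP; rewrite orbC negb_or.
  by apply: (gap _ _ _ _ z1E); lia.
have {pr rp} rE : r = p by lia.
apply: (@rotated_of_agree _ _ (ordS z1) (s (ordS z1))) => t tn.
case: (ltnP t p) => tp; first exact: block1.
have z2E' : ordS z2 = step p (ordS z1) by rewrite step_ordS z2E.
rewrite -(subnK tp) !iterD -z2E' -rE -sE; apply: block2; lia.
Qed.

End CyclicIndices.

(** * Unitary equivalence of weighted shifts *)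

Section WeightedShift.

Variables (C : numClosedFieldType) (n : nat).
Implicit Types (a b d : 'I_n -> C).

Local Notation step k := (iter k (@ordS n)).
Local Notation diag d := (monomial_mx d 1%g).

Lemma weighted_shiftE a : weighted_shift a = monomial_mx a (rotation n).
Proof.
apply/matrixP => i j; rewrite !mxE permE eq_sym.
by case: eqP => _; rewrite ?mulr1n.
Qed.

(** Applied repeatedly to the identity, [D |-> A D A^H] gives [A^k (A^H)^k], one
factor of the prefix product at a time. *)
Lemma weighted_shift_compress a d :
  weighted_shift a *m diag d *m (weighted_shift a)^t* =
    diag (fun i => `|a i| ^+ 2 * d (ordS i)).
Proof.
rewrite weighted_shiftE trmxC_monomial_mx !mul_monomial_mx mulg1 mulgV.
apply: eq_monomial_mx => i; rewrite permK permE normCK.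
by rewrite mulrAC.
Qed.

Lemma weighted_shift_gram a :
  (weighted_shift a)^t* *m weighted_shift a =
    diag (fun i => `|a (ord_pred i)| ^+ 2).
Proof.
rewrite weighted_shiftE trmxC_monomial_mx mul_monomial_mx mulVg.
apply: eq_monomial_mx => i; rewrite normCKC.
suff -> : (rotation n)^-1%g i = ord_pred i by [].
by apply: (@perm_inj _ (rotation n)); rewrite permKV permE ord_predK.
Qed.

(** The diagonal matrices are [A^k (A^H)^k] and [B^k (B^H)^k]. *)
Lemma intertwine_prefix_products a b (U : 'M[C]_n) k :
    weighted_shift a *m U = U *m weighted_shift b ->
    (weighted_shift a)^t* *m U = U *m (weighted_shift b)^t* ->
  diag (fun i => \prod_(t < k) `|a (step t i)| ^+ 2) *m U =
    U *m diag (fun i => \prod_(t < k) `|b (step t i)| ^+ 2).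
Proof.
move=> AU AsU; elim: k => [|k IHk].
  have one f : diag (fun i => \prod_(t < 0) f t i) = 1%:M :> 'M[C]_n.
    rewrite -monomial_mx1; apply: eq_monomial_mx => i.
    by rewrite big_ord0.
  by rewrite !one mul1mx mulmx1.
have rec (f : 'I_n -> C) : diag (fun i => \prod_(t < k.+1) `|f (step t i)| ^+ 2) =
    weighted_shift f *m diag (fun i => \prod_(t < k) `|f (step t i)| ^+ 2)
      *m (weighted_shift f)^t*.
  rewrite weighted_shift_compress; apply: eq_monomial_mx => i.
  rewrite big_ord_recl; congr (_ * _); apply: eq_bigr => t _.
  by rewrite step_ordS.
by rewrite !rec -[LHS]mulmxA AsU mulmxA -(mulmxA _ _ U) IHk !mulmxA AU.
Qed.

(** The prefix products and the Gram matrix [A^H A] supply the hypotheses of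
[rotated_of_prefix_products], with squared moduli as letters. *)
Lemma weighted_shift_equiv_only_if a b :
    (0 < n)%N -> (#|[set j | a j == 0%R]| <= 2)%N ->
    unitarily_equivalent (weighted_shift a) (weighted_shift b) ->
  \prod_j a j = \prod_j b j /\
  exists k, (1 <= k <= n)%N /\ forall j, `|a j| = `|b (step k j)|.
Proof.
move=> n0 cardZ [U Uunit BE].
have UUs : U *m U^t* = 1%:M by apply/unitarymxP.
have AU : weighted_shift a *m U = U *m weighted_shift b.
  by rewrite BE !mulmxA UUs mul1mx.
have AsU : (weighted_shift a)^t* *m U = U *m (weighted_shift b)^t*.
  by rewrite BE !trmx_mul !map_mxM trmxCK !mulmxA UUs mul1mx.
have detU : \det U != 0 by rewrite -unitfE -unitmxE unitarymx_unit.
split.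
  have := congr1 determinant AU.
  rewrite !weighted_shiftE !det_mulmx !det_monomial_mx mulrC => /(mulfI detU).
  by apply: mulIf; rewrite signr_eq0.
have [s Us] := det_neq0_transversal detU.
have [|||k [kn kP]] := @rotated_of_prefix_products n C (fun i => `|a i| ^+ 2)
    (fun i => `|b i| ^+ 2) s perm_inj _ _ n0.
- move=> i k; exact: diag_intertwine (intertwine_prefix_products k AU AsU) (Us i).
- move=> i; have gramU : (weighted_shift a)^t* *m weighted_shift a *m U =
      U *m ((weighted_shift b)^t* *m weighted_shift b).
    by rewrite -mulmxA AU mulmxA AsU -mulmxA.
  rewrite !weighted_shift_gram in gramU.
  exact: diag_intertwine gramU (Us i).
- rewrite (_ : [set j | _] = [set j | a j == 0%R]) //.
  by apply/setP => j; rewrite !inE sqrf_eq0 normr_eq0.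
exists k; split=> // j; have /eqP := kP j.
by rewrite eqrXn2 // => /eqP.
Qed.

(** Off the zeros of [a] the phase is forced to be [b j / a j]. At a zero it is
free: without a zero the product is [1] because the two products agree, and
with a zero [m] the phase at [m] is chosen to make it [1]. *)
Lemma phases_exist a b :
    (forall j, `|a j| = `|b j|) -> \prod_j a j = \prod_j b j ->
  exists u : 'I_n -> C,
    [/\ forall j, `|u j| = 1, forall j, a j * u j = b j & \prod_j u j = 1].
Proof.
move=> ab prod_ab.
pose v j := if a j == 0 then 1 else b j / a j.
have v1 j : `|v j| = 1.
  rewrite /v; case: eqVneq => [|aj]; first by rewrite normr1.
  by rewrite normf_div -ab divff ?normr_eq0.
have av j : a j * v j = b j.
  rewrite /v; case: eqVneq => [aj|aj]; last by rewrite mulrC divfK.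
  by rewrite aj mul0r; apply/esym/eqP; rewrite -normr_eq0 -ab aj normr0.
have [/existsP[m /eqP am]|/existsPn nz] := boolP [exists m, a m == 0]; last first.
  exists v; split=> //; have := prod_ab.
  have A0 : \prod_j a j != 0 by apply/prodf_neq0.
  rewrite -(eq_bigr _ (fun j _ => av j)) big_split /= -{1}[\prod_j a j]mulr1.
  by move/(mulfI A0).
have w1 : `|\prod_(j | j != m) v j| = 1.
  by rewrite normr_prod big1.
exists (fun j => if j == m then (\prod_(j | j != m) v j)^-1 else v j); split.
- by move=> j; case: eqP => // _; rewrite normfV w1 invr1.
- move=> j; case: eqP => [->|_ //].
  by rewrite am mul0r; apply/esym/eqP; rewrite -normr_eq0 -ab am normr0.
rewrite (bigD1 m) //= eqxx [X in _ * X](eq_bigr v) => [|j /negPf-> //].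
by rewrite mulVf // -normr_eq0 w1 oner_eq0.
Qed.

(** The partial products of [u] satisfy the recurrence; it closes up when it
wraps around from [n - 1] to [0] because the full product is [1]. *)
Lemma cyclic_primitive (u : 'I_n -> C) :
    (forall j, `|u j| = 1) -> \prod_j u j = 1 ->
  exists2 d : 'I_n -> C, forall i, `|d i| = 1 & forall i, d (ordS i) = d i * u i.
Proof.
move=> u1 produ; exists (fun i => \prod_(j < n | (j < i)%N) u j) => i.
  by rewrite normr_prod big1.
have -> : \prod_(j < n | (j < i)%N) u j * u i = \prod_(j < n | (j < i.+1)%N) u j.
  rewrite mulrC [RHS](bigD1 i) //=; congr (_ * _); apply: eq_bigl => j.
  by rewrite ltnS ltn_neqAle andbC.
have := ltn_ord i; rewrite leq_eqVlt => /orP[/eqP iE|ltin].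
  rewrite /= {1}iE modnn big_pred0 // -[LHS]produ; apply: eq_bigl => j.
  by rewrite iE ltn_ord.
by rewrite /= modn_small.
Qed.

(** The unitary is [diag d * P^k], where [P] is the cyclic permutation matrix:
[P^k] rotates the weights of [b] by [k] places and [d] corrects the phases. *)
Lemma weighted_shift_equiv_if a b k :
    \prod_j a j = \prod_j b j -> (forall j, `|a j| = `|b (step k j)|) ->
  unitarily_equivalent (weighted_shift a) (weighted_shift b).
Proof.
move=> prod_ab ab.
have prod_b : \prod_j b j = \prod_j b (step k j).
  rewrite (reindex_inj (@perm_inj _ (rotation n ^+ k)%g)).
  by apply: eq_bigr => j _; rewrite rotationX.
have [|u [u1 au produ]] := phases_exist ab; first by rewrite prod_ab.
have [d d1 dS] := cyclic_primitive u1 produ.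
pose U := monomial_mx d (rotation n ^+ k)%g.
have Uunit : U \is unitarymx by apply: monomial_mx_unitary.
have /unitarymxP/mulmx1C UsU := Uunit.
exists U => //; suff AU : weighted_shift a *m U = U *m weighted_shift b.
  by rewrite -mulmxA AU mulmxA UsU mul1mx.
rewrite !weighted_shiftE !mul_monomial_mx -expgS expgSr.
apply: eq_monomial_mx => i.
by rewrite permE rotationX dS -au mulrCA.
Qed.

End WeightedShift.

(* [iter k (@ordS n) j] is the index j + k modulo n. *)
Theorem theorem2p3 (R : realType) (n : nat) (a b : 'I_n -> R[i])
    (hn : (3 <= n)%N)
    (ha : (#|[set j : 'I_n | a j == 0%R]| <= 2)%N) :
  unitarily_equivalent (weighted_shift a) (weighted_shift b) <->
  (\prod_(j < n) a j = \prod_(j < n) b j /\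
   exists k : nat, (1 <= k <= n)%N /\
     forall j : 'I_n, `|a j| = `|b (iter k (@ordS n) j)|).
Proof.
split; last by move=> [prod_ab [k [_ ab]]]; exact: weighted_shift_equiv_if ab.
exact: weighted_shift_equiv_only_if (ltnW (ltnW hn)) ha.
Qed.
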